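(* Let $\mathcal{H}=\mathcal{V}\oplus\mathcal{W}^{\perp}$. Let $(\mathbf{W},\mathbf{w})$ be a fusion frame for $\mathcal{W}$, $(\mathbf{V},\mathbf{v})$ a fusion frame for $\mathcal{V}$, $Q\in B(\mathcal{K}_{\mathbf{W}},\mathcal{K}_{\mathbf{V}})$ and $\epsilon\ge0$. Then: (i) If $f_r=T_{\mathbf{V},\mathbf{v}}QT_{\mathbf{W},\mathbf{w}}^{*}f$ is an $\frac{\epsilon}{\|\pi_{\mathcal{V},\mathcal{W}^{\perp}}\|\,\|T_{\mathbf{W},\mathbf{w}}^{\dagger}\|}$-consistent reconstruction of $f$ in $\mathcal{V}$ for each $f\in\mathcal{H}$, then $(\mathbf{W},\mathbf{w})$ and $(\mathbf{V},\mathbf{v})$ are $\epsilon$-approximate oblique $Q$-dual fusion frames, i.e. $(\mathbf{V},\mathbf{v})$ is an $\epsilon$-approximate oblique $Q$-dual fusion frame of $(\mathbf{W},\mathbf{w})$ on $\mathcal{V}$. (ii) If $(\mathbf{V},\mathbf{v})$ is an $\epsilon$-approximate oblique $Q$-dual fusion frame of $(\mathbf{W},\mathbf{w})$ on $\mathcal{V}$, then $f_r=T_{\mathbf{V},\mathbf{v}}QT_{\mathbf{W},\mathbf{w}}^{*}f$ is an $\epsilon\|T_{\mathbf{W},\mathbf{w}}\|$-consistent reconstruction of $f$ in $\mathcal{V}$, for each $f\in\mathcal{H}$.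
   Context: $\mathcal{H}$ is a separable Hilbert space over $\mathbb{R}$ or $\mathbb{C}$, $\mathcal{V},\mathcal{W}$ are closed subspaces of $\mathcal{H}$, $I$ is a countable index set, and $B(\cdot,\cdot)$ denotes bounded linear operators. $\mathcal{H}=\mathcal{V}\oplus\mathcal{W}^{\perp}$ means a direct (not necessarily orthogonal) sum; $\pi_{\mathcal{V},\mathcal{W}^{\perp}}$ is the oblique projection with image $\mathcal{V}$ and kernel $\mathcal{W}^{\perp}$. $\mathbf{W}=\{W_i\}_{i\in I}$ is a family of closed subspaces of $\mathcal{W}$ and $\mathbf{w}=\{w_i\}_{i\in I}\in\ell^\infty(I)$ a family of weights, i.e. $w_i>0$ for all $i$. $\mathcal{K}_{\mathbf{W}}=\oplus_{i\in I}W_i$ is the Hilbert ($\ell^2$) direct sum. $(\mathbf{W},\mathbf{w})=\{(W_i,w_i)\}_{i\in I}$ is a fusion frame for $\mathcal{W}$ if there are $0<\alpha\le\beta<\infty$ with $\alpha\|f\|^2\le\sum_{i\in I}w_i^2\|\pi_{W_i}f\|^2\le\beta\|f\|^2$ for all $f\in\mathcal{W}$ ($\pi_{W_i}$ the orthogonal projection onto $W_i$). The synthesis operator $T_{\mathbf{W},\mathbf{w}}:\mathcal{K}_{\mathbf{W}}\to\mathcal{H}$, $(f_i)_{i}\mapsto\sum_i w_if_i$, is then bounded with image $\mathcal{W}$, and its adjoint is $T_{\mathbf{W},\mathbf{w}}^{*}f=(w_i\pi_{W_i}f)_{i}$. The same notation is used for $(\mathbf{V},\mathbf{v})$ with closed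 subspaces $V_i$ of $\mathcal{V}$. $T^{\dagger}$ denotes the Moore–Penrose pseudo-inverse of a bounded operator $T$ with closed range. $(\mathbf{V},\mathbf{v})$ is an $\epsilon$-approximate oblique $Q$-dual fusion frame of $(\mathbf{W},\mathbf{w})$ on $\mathcal{V}$ if $\|T_{\mathbf{V},\mathbf{v}}QT_{\mathbf{W},\mathbf{w}}^{*}-\pi_{\mathcal{V},\mathcal{W}^{\perp}}\|\le\epsilon$. For $\eta\ge0$ and $f\in\mathcal{H}$, a vector $f_r\in\mathcal{V}$ is an $\eta$-consistent reconstruction of $f$ in $\mathcal{V}$ if $\|T_{\mathbf{W},\mathbf{w}}^{*}f_r-T_{\mathbf{W},\mathbf{w}}^{*}f\|\le\eta\|f\|$. *)

(* Defs.v *)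
From HB Require Import structures.
From mathcomp Require Import all_boot all_order all_algebra finmap.
From mathcomp Require Import sesquilinear complex.
From mathcomp Require Import all_classical all_reals ereal topology normedtype.
From mathcomp Require Import esum ring lra.
From mathcomp Require summability.

Set Implicit Arguments.
Unset Strict Implicit.
Unset Printing Implicit Defensive.

Import Order.TTheory GRing.Theory Num.Theory.
Import numFieldNormedType.Exports.

Local Open Scope classical_set_scope.
Local Open Scope ring_scope.

(* The real and the complex case are treated uniformly: [scalar R k] is R or
   R[i], and [conj R k] is the identity or the complex conjugation. *)
Variant base_field := RealField | ComplexField.

Definition scalar (R : realType) (k : base_field) : numFieldType :=
  match k with RealField => R | ComplexField => R[i] end.

Definition conj (R : realType) (k : base_field) :
    {rmorphism scalar R k -> scalar R k} :=
  match k with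
  | RealField => idfun
  | ComplexField => @conjc R
  end.

Definition re (R : realType) (k : base_field) : scalar R k -> R :=
  match k with
  | RealField => id
  | ComplexField => @complex.Re R
  end.
Arguments re {R k}.

Definition ofR (R : realType) (k : base_field) : R -> scalar R k :=
  match k with
  | RealField => id
  | ComplexField => real_complex R
  end.
Arguments ofR {R k}.

HB.mixin Record Lmodule_isPreHilbert (R : realType) (k : base_field) V
    of GRing.Lmodule (scalar R k) V := {
  dot : {dot V for conj R k}
}.

#[short(type="preHilbertType")]
HB.structure Definition PreHilbert (R : realType) (k : base_field) :=
  {V of GRing.Lmodule (scalar R k) V & Lmodule_isPreHilbert R k V}.
Arguments dot {R k s}.

(* The norm `|x| of a module over [scalar R k] takes its values in
   [scalar R k]; the mixin says that it is the norm induced by [dot]. *)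
HB.mixin Record PreHilbert_isHilbert (R : realType) (k : base_field) H
    of PreHilbert R k H & CompleteNormedModule (scalar R k) H := {
  sqr_norm_dot : forall x : H, `|x| ^+ 2 = dot x x
}.

#[short(type="hilbertType")]
HB.structure Definition Hilbert (R : realType) (k : base_field) :=
  {H of PreHilbert R k H & CompleteNormedModule (scalar R k) H
      & PreHilbert_isHilbert R k H}.

(* The same norm with values in R; see [norm_hnorm]. *)
Definition hnorm (R : realType) (k : base_field) (V : preHilbertType R k)
  (x : V) : R := Num.sqrt (re (dot x x)).

Definition separable (T : topologicalType) :=
  exists D : set T, countable D /\ dense D.

Section ScalarTheory.
Context {R : realType} {k : base_field}.
Local Notation K := (scalar R k).
Implicit Types a b : K.

Lemma mul_conj a : a * conj R k a = `|a| ^+ 2.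
Proof.
case: k a => [a|[x y]] /=; first by rewrite real_normK ?num_real// expr2.
rewrite normc_def/= -rmorphXn/= sqr_sqrtr ?addr_ge0 ?sqr_ge0//.
by apply/eqP; rewrite eq_complex/= !expr2; apply/andP; split; apply/eqP; ring.
Qed.

Lemma conjK a : conj R k (conj R k a) = a.
Proof. by case: k a => [a|a] //=; rewrite conjcK. Qed.

Lemma norm_conj a : `|conj R k a| = `|a|.
Proof.
by apply/eqP; rewrite -(eqrXn2 (n := 2)) ?normr_ge0// -!mul_conj conjK mulrC.
Qed.

Lemma conj_norm a : conj R k `|a| = `|a|.
Proof. by case: k a => // a; rewrite normc_def; exact: conjc_real. Qed.

Lemma re_ge0 a : 0 <= a -> 0 <= re a.
Proof. by case: k a => [a|a] //=; rewrite lecE/= => /andP[]. Qed.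

Lemma reD a b : re (a + b) = re a + re b.
Proof. by case: k a b => [a b|[x y] [x' y']]. Qed.

Lemma re0 : re (0 : K) = 0.
Proof. by case: k. Qed.

Lemma reM a b : 0 <= a -> re (a * b) = re a * re b.
Proof.
case: k a b => [a b|[x y] [x' y']] //=; rewrite lecE/= => /andP[/eqP/= -> _].
by rewrite mul0r subr0.
Qed.

Lemma re_le a b : a <= b -> re a <= re b.
Proof. by case: k a b => [a b|a b] //=; rewrite lecE/= => /andP[]. Qed.

Lemma re_nneg_eq0 a : 0 <= a -> re a = 0 -> a = 0.
Proof.
case: k a => [a|[x y]] //=; rewrite lecE/= => /andP[/eqP/= -> _] ->.
by [].
Qed.

Lemma ofR_ge0 (r : R) : 0 <= r -> 0 <= ofR r :> K.
Proof. by case: k => //= r0; rewrite lecE/= eqxx. Qed.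

Lemma ofRX (r : R) n : ofR r ^+ n = ofR (r ^+ n) :> K.
Proof. by case: k => //; rewrite /ofR rmorphXn. Qed.

Lemma ofR_re a : 0 <= a -> ofR (re a) = a.
Proof. by case: k a => [|] //= [y z]; rewrite lecE/= => /andP[/eqP/= ->]. Qed.

End ScalarTheory.

Section PreHilbertTheory.
Context {R : realType} {k : base_field} {V : preHilbertType R k}.
Local Notation K := (scalar R k).
Implicit Types (u v : V) (a : K).

Lemma dotDl u v x : dot (u + v) x = dot u x + dot v x.
Proof. exact: linearDl. Qed.
Lemma dotC u v : dot u v = conj R k (dot v u).
Proof. by rewrite (hermC (dot : {dot V for conj R k})) expr0 mul1r. Qed.
Lemma dotZl a u v : dot (a *: u) v = a * dot u v.
Proof. exact: linearZl_LR. Qed.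

Lemma dot_ge0 u : 0 <= dot u u.
Proof.
have [->|u0] := eqVneq u 0; first by rewrite linear0l.
exact/ltW/neq0_dnorm_gt0.
Qed.

Lemma dot_eq0 u : dot u u = 0 -> u = 0.
Proof.
move=> uu; apply/eqP; apply: contraT => u0.
have : 0 < dot u u by exact: neq0_dnorm_gt0.
by rewrite uu ltxx.
Qed.

Lemma sqr_hnorm u : hnorm u ^+ 2 = re (dot u u).
Proof. by rewrite sqr_sqrtr// re_ge0// dot_ge0. Qed.

Lemma dotDr u v x : dot x (u + v) = dot x u + dot x v.
Proof. exact: linearDr. Qed.

Lemma dotZr a u v : dot u (a *: v) = conj R k a * dot u v.
Proof. by rewrite dotC dotZl rmorphM/= -dotC. Qed.

Lemma le_dot u v : `|dot u v| <= dot u u + dot v v.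
Proof.
set z := dot u v.
have [->|z0] := eqVneq z 0; first by rewrite normr0 addr_ge0 ?dot_ge0.
pose c := z / `|z|.
have nz : `|z| != 0 by rewrite normr_eq0.
have := dot_ge0 (u - c *: v).
rewrite -scaleNr dotDl !dotDr !dotZl !dotZr.
have -> : dot v u = conj R k z by rewrite -dotC.
rewrite -/z !rmorphN/= /c rmorphM/= fmorphV/=.
rewrite conj_norm.
set d := conj R k z.
have zd : z * d = `|z| ^+ 2 by rewrite mul_conj.
have -> : dot u u + - (d / `|z|) * z + (- (z / `|z|) * d + - (z / `|z|) * (- (d / `|z|) * dot v v))
  = dot u u + dot v v - `|z| *+ 2.
  have -> : - (d / `|z|) * z = - (z * d) / `|z| by ring.
  have -> : - (z / `|z|) * d = - (z * d) / `|z| by ring.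
  have -> : - (z / `|z|) * (- (d / `|z|) * dot v v) = (z * d) / `|z| / `|z| * dot v v by ring.
  rewrite zd expr2 mulfK// mulNr mulfK// divff// mul1r mulr2n; ring.
rewrite subr_ge0; apply: le_trans.
by rewrite mulr2n lerDl.
Qed.

Lemma dotD_le u v : dot (u + v) (u + v) <= (dot u u + dot v v) *+ 2.
Proof.
rewrite -subr_ge0; have := dot_ge0 (u - v).
rewrite -scaleN1r !dotDl !dotDr !dotZl !dotZr rmorphN1.
set a := dot u u; set b := dot u v; set c := dot v u; set d := dot v v.
suff -> : a + -1 * b + (-1 * c + -1 * (-1 * d)) = (a + d) *+ 2 - (a + b + (c + d)) by [].
ring.
Qed.

Lemma dotZZ a u : dot (a *: u) (a *: u) = `|a| ^+ 2 * dot u u.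
Proof. by rewrite dotZl dotZr mulrA mul_conj. Qed.
End PreHilbertTheory.

Section Sums.
Import summability.
#[local] Existing Instance totally_filter.

Lemma partial_sumE (I : choiceType) (V : zmodType) (x : I -> V) (J : {fset I}) :
  partial_sum x J = \sum_(i <- J) x i.
Proof. by rewrite /partial_sum big_seq_fsetE. Qed.

Lemma nonneg_sum_cvg (R : realType) (I : choiceType) (a : I -> R) (M : R) :
  (forall i, 0 <= a i) -> (forall J : {fset I}, \sum_(i <- J) a i <= M) ->
  exists l : R, partial_sum a @ totally --> l.
Proof.
move=> a0 aM; pose A := [set \sum_(i <- (J : {fset I})) a i | J in setT].
have supA : has_sup A.
  split; first by exists (\sum_(i <- (fset0 : {fset I})) a i), fset0.
  by exists M => _ [J _ <-].
exists (sup A); apply/cvgrPdist_le => e e0.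
have [_ [J _ <-] Je] := sup_adherent e0 supA.
exists J => // J' /= JJ'; rewrite partial_sumE.
have le1 : \sum_(i <- J') a i <= sup A by apply: ub_le_sup; [exact: supA.2|exists J'].
have le2 : \sum_(i <- J) a i <= \sum_(i <- J') a i.
  rewrite [leRHS](big_fsetID _ [in J])/=.
  have -> : [fset x in J' | x \in J]%fset = J.
    apply/fsetP => x; rewrite !inE; apply: andb_idl => xJ.
    exact: (fsubsetP JJ').
  by rewrite lerDl sumr_ge0.
by rewrite ger0_norm ?subr_ge0//; lra.
Qed.

Lemma partial_sumD (I : choiceType) (V : zmodType) (x y : I -> V) :
  partial_sum (fun i => x i + y i) = (fun J => partial_sum x J + partial_sum y J).
Proof. by apply/funext => J; rewrite !partial_sumE big_split. Qed.

Lemma real_abs_cvg (R : realType) (I : choiceType) (a : I -> R) (M : R) :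
  (forall J : {fset I}, \sum_(i <- J) `|a i| <= M) ->
  exists l : R, partial_sum a @ totally --> l.
Proof.
move=> aM.
have [l1 h1] : exists l : R, partial_sum (fun i => `|a i| + a i) @ totally --> l.
  apply: (@nonneg_sum_cvg _ _ _ (M + M)) => [i|J].
    by have := ler_norm (- a i); rewrite normrN; lra.
  rewrite big_split lerD ?aM//; apply: le_trans (aM J).
  by apply: ler_sum => i _; exact: ler_norm.
have [l2 h2] := @nonneg_sum_cvg _ _ _ M (fun i => normr_ge0 (a i)) aM.
exists (l1 - l2).
have -> : partial_sum a = (fun J => partial_sum (fun i => `|a i| + a i) J
    - partial_sum (fun i => `|a i|) J).
  by apply/funext => J; rewrite partial_sumD addrAC subrr add0r.
exact: cvgB h1 h2.
Qed.

Lemma scalar_abs_cvg (R : realType) k (I : choiceType) (a : I -> scalar R k)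
    (M : R) :
  (forall J : {fset I}, \sum_(i <- J) re `|a i| <= M) ->
  exists l : scalar R k, partial_sum a @ totally --> l.
Proof.
case: k a M => a M aM; first exact: real_abs_cvg aM.
have bnd (f : R[i] -> R) : (forall z, `|f z| <= complex.Re `|z|) ->
    exists l : R, partial_sum (fun i => f (a i)) @ totally --> l.
  move=> fz; apply: (@real_abs_cvg _ _ _ M) => J.
  by apply: le_trans (aM J); apply: ler_sum.
have [x xP] : exists l : R, partial_sum (fun i => complex.Re (a i)) @ totally --> l.
  apply: bnd => z; rewrite normc_def/= -sqrtr_sqr ler_wsqrtr// lerDl sqr_ge0//.
have [y yP] : exists l : R, partial_sum (fun i => complex.Im (a i)) @ totally --> l.
  apply: bnd => z; rewrite normc_def/= -sqrtr_sqr ler_wsqrtr// lerDr sqr_ge0//.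
exists (Complex x y : scalar R ComplexField); apply/cvgrPdist_le => -[e e'].
rewrite ltcE/= => /andP[/eqP-> e0].
move/cvgrPdist_le : xP => /(_ (e/2)); rewrite divr_gt0// => /(_ isT) xP.
move/cvgrPdist_le : yP => /(_ (e/2)); rewrite divr_gt0// => /(_ isT) yP.
apply: (@filterS _ totally _ _ _ _ (@filterI _ totally _ _ _ xP yP)) => J [].
rewrite !partial_sumE => hx hy.
have sumC (J' : seq I) : \sum_(i <- J') a i = Complex (\sum_(i <- J') complex.Re (a i))
    (\sum_(i <- J') complex.Im (a i)).
  elim: J' => [|i s IH]; first by rewrite !big_nil.
  by rewrite !big_cons IH; case: (a i).
rewrite sumC normc_def lecE/= eqxx/=.
rewrite -[leRHS](ger0_norm (ltW e0)) -sqrtr_sqr ler_wsqrtr//.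
have sq (p : R) : `|p| <= e / 2 -> p ^+ 2 <= (e / 2) ^+ 2.
  by rewrite ler_norml => /andP[? ?]; nra.
by have := sq _ hx; have := sq _ hy; nra.
Qed.

Section Limits.
Context {R : realType} {k : base_field} {I : choiceType}.
Local Notation K := (scalar R k).
Implicit Types a b : I -> K.

Lemma sum_unique a (l : K) : partial_sum a @ totally --> l -> sum a = l.
Proof. exact: cvg_lim. Qed.

Lemma cvg_sumD a b (l m : K) :
  partial_sum a @ totally --> l -> partial_sum b @ totally --> m ->
  partial_sum (fun i => a i + b i) @ totally --> l + m.
Proof. by move=> al bm; rewrite partial_sumD; exact: cvgD. Qed.

Lemma cvg_sumZ a (c l : K) :
  partial_sum a @ totally --> l ->
  partial_sum (fun i => c * a i) @ totally --> c * l.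
Proof.
have -> : partial_sum (fun i => c * a i) = (fun J => c * partial_sum a J).
  by apply/funext => J; rewrite !partial_sumE mulr_sumr.
by move=> al; apply: cvgM => //; exact: cvg_cst.
Qed.

Lemma cvg_sum_conj a (l : K) :
  partial_sum a @ totally --> l ->
  partial_sum (fun i => conj R k (a i)) @ totally --> conj R k l.
Proof.
have -> : partial_sum (fun i => conj R k (a i)) = (fun J => conj R k (partial_sum a J)).
  by apply/funext => J; rewrite !partial_sumE rmorph_sum.
move=> /cvgrPdist_le al; apply/cvgrPdist_le => e e0.
apply: (@filterS _ totally _ _ _ _ (al e e0)) => J.
by rewrite -rmorphB norm_conj.
Qed.

Lemma cvg_sum_ge a (l : K) i : (forall j, 0 <= a j) ->
  partial_sum a @ totally --> l -> a i <= l.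
Proof.
move=> a0 al; rewrite -subr_ge0.
suff -> : l - a i = `|l - a i| by exact: normr_ge0.
have al' : (fun J => partial_sum a J - a i) @ totally --> l - a i.
  by apply: cvgB => //; exact: cvg_cst.
have nal : (fun J => `|partial_sum a J - a i|) @ totally --> `|l - a i|.
  exact: cvg_norm.
rewrite -[LHS](cvg_lim (@norm_hausdorff _ _) al').
apply: cvg_lim; first exact: norm_hausdorff.
apply: cvg_trans nal.
apply: near_eq_cvg; exists [fset i]%fset => // J /=.
rewrite fsub1set => iJ; rewrite ger0_norm// partial_sumE (big_fsetD1 i)//=.
by rewrite addrAC subrr add0r sumr_ge0.
Qed.
End Limits.
End Sums.

Section ClosedSubspace.
Context (R : realType) (k : base_field) (H : hilbertType R k).

Record closedSubspace := ClosedSubspace {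
  subspace_set :> set H;
  subspace0 : subspace_set 0;
  subspaceP : forall (a : scalar R k) x y,
    subspace_set x -> subspace_set y -> subspace_set (a *: x + y);
  subspace_closed : closed subspace_set
}.

Definition orthocomp (A : set H) : set H :=
  [set x | forall y, A y -> dot x y = 0].

(* The M-component of x when H is the direct sum of M and N; its image is then
   M and its kernel N. *)
Definition projection (M N : set H) (x : H) : H :=
  xget 0 [set p | M p /\ N (x - p)].

Definition direct_sum (M N : set H) :=
  (forall x, exists2 p, M p & N (x - p)) /\ M `&` N = [set 0].

Definition oproj (M : set H) : H -> H := projection M (orthocomp M).

End ClosedSubspace.

Lemma norm_hnorm (R : realType) (k : base_field) (H : hilbertType R k) (x : H) :
  `|x| = ofR (hnorm x).
Proof.
apply/eqP; rewrite -(eqrXn2 (n := 2)) ?normr_ge0 ?ofR_ge0 ?sqrtr_ge0//.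
by rewrite ofRX sqr_hnorm sqr_norm_dot ofR_re ?dot_ge0.
Qed.

Section L2Sum.
Context (R : realType) (k : base_field) (H : hilbertType R k).
Context (I : countType) (W : I -> closedSubspace H).
Local Notation K := (scalar R k).

(* [l2sum W] is the l2 direct sum of the subspaces W i: the families f with
   f i in W i whose squared norms are summable, with the inner product
   sum_i <f i, g i>. The sum is the unconditional one, i.e. the limit of the
   partial sums along the directed set of finite subsets of I. *)
Definition l2pred : pred (I -> H) := [pred f |
  `[< (forall i, subspace_set (W i) (f i)) /\
      (\esum_(i in [set: I]) (hnorm (f i) ^+ 2)%:E < +oo)%E >]].

Record l2sum := L2Sum { l2fam :> I -> H; _ : l2fam \in l2pred }.
HB.instance Definition _ := [isSub for l2fam].
HB.instance Definition _ := [Choice of l2sum by <:].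

Lemma l2predP (f : I -> H) : f \in l2pred <->
  (forall i, subspace_set (W i) (f i)) /\
  exists M : R, forall J : {fset I}, \sum_(i <- J) re (dot (f i) (f i)) <= M.
Proof.
split=> [/asboolP[fW fE]|[fW fE]]; last (apply/asboolP); split => //.
- exists (fine (\esum_(i in [set: I]) (hnorm (f i) ^+ 2)%:E)) => J.
  have fin : (\esum_(i in [set: I]) (hnorm (f i) ^+ 2)%:E)%E \is a fin_num.
    by rewrite ge0_fin_numE// esum_ge0// => i _; rewrite lee_fin sqr_ge0.
  rewrite -lee_fin fineK//; apply: ereal_sup_ubound; exists [set` J] => //.
  rewrite fsbig_finite//= set_fsetK sumEFin; congr EFin.
  by apply: eq_bigr => i _; rewrite sqr_hnorm.
- have [M fM] := fE; apply: (@le_lt_trans _ _ M%:E); last exact: ltry.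
  apply: ge_ereal_sup => _ [A [finA _] <-].
  rewrite fsbig_finite//= sumEFin lee_fin; apply: le_trans (fM _).
  by apply: ler_sum => i _; rewrite sqr_hnorm.
Qed.

Lemma l2_submod : submod_closed l2pred.
Proof.
split; first apply/l2predP; first split => [i|].
- exact: subspace0.
- by exists 0 => J; rewrite big1// => i _; rewrite linear0l re0.
move=> a f g /l2predP[fW [M fM]] /l2predP[gW [N gN]]; apply/l2predP; split.
  by move=> i; exact: subspaceP.
exists ((re (`|a| ^+ 2) * M + N) *+ 2) => J.
apply: (@le_trans _ _ (\sum_(i <- J)
    (re (`|a| ^+ 2) * re (dot (f i) (f i)) + re (dot (g i) (g i))) *+ 2)).
  apply: ler_sum => i _; have := re_le (dotD_le (a *: f i) (g i)).
  by rewrite mulr2n !reD dotZZ reM ?exprn_ge0 ?normr_ge0// -mulr2n.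
rewrite sumrMnl lerMn2r/= big_split/= -mulr_sumr lerD//.
by rewrite ler_wpM2l// re_ge0// exprn_ge0.
Qed.

HB.instance Definition _ := GRing.isSubmodClosed.Build _ _ l2pred l2_submod.
HB.instance Definition _ := [SubChoice_isSubLmodule of l2sum by <:].

(* The summands are absolutely summable, see [l2dot_cvg]. *)
Definition l2dot (f g : l2sum) : K := summability.sum (fun i => dot (f i) (g i)).

Lemma l2dot_cvg (f g : l2sum) :
  summability.partial_sum (fun i => dot (f i) (g i)) @ summability.totally
    --> l2dot f g.
Proof.
have [_ [M fM]] := (l2predP _).1 (valP f).
have [_ [N gN]] := (l2predP _).1 (valP g).
have fgM (J : {fset I}) : \sum_(i <- J) re `|dot (f i) (g i)| <= M + N.
  apply: le_trans (lerD (fM J) (gN J)); rewrite -big_split/=.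
  by apply: ler_sum => i _; rewrite -reD; apply/re_le/le_dot.
have [l al] := scalar_abs_cvg fgM.
by rewrite /l2dot (sum_unique al).
Qed.

Lemma l2dot_linearl g : linear_for *%R (l2dot ^~ g).
Proof.
move=> a f f'; apply: sum_unique.
have -> : (fun i => dot ((a *: f + f') i) (g i)) =
    (fun i => a * dot (f i) (g i) + dot (f' i) (g i)).
  by apply/funext => i; rewrite -dotZl -dotDl.
by apply: cvg_sumD; [apply: cvg_sumZ|]; exact: l2dot_cvg.
Qed.

Lemma l2dotC f g : l2dot f g = (-1) ^+ false * conj R k (l2dot g f).
Proof.
rewrite expr0 mul1r; apply: sum_unique.
have -> : (fun i => dot (f i) (g i)) = (fun i => conj R k (dot (g i) (f i))).
  by apply/funext => i; exact: dotC.
by apply: cvg_sum_conj; exact: l2dot_cvg.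
Qed.

Lemma l2dot_linearr f : linear_for (conj R k \; *%R) (l2dot f).
Proof.
move=> a g g'; rewrite l2dotC expr0 mul1r l2dot_linearl rmorphD rmorphM/=.
by rewrite (l2dotC f g) (l2dotC f g') !expr0 !mul1r.
Qed.

Lemma l2dot_gt0 f : f != 0 -> 0 < l2dot f f.
Proof.
move=> f0; have [i fi0] : exists i, f i != 0.
  apply: contrapT => /forallNP h; move/eqP: f0; apply; apply/val_inj/funext => i.
  by apply/eqP/negPn/negP => /h.
apply: lt_le_trans (neq0_dnorm_gt0 _ fi0) _ => /=.
apply: (@cvg_sum_ge _ _ _ (fun i => dot (f i) (f i)) _ i (fun j => dot_ge0 _)).
exact: l2dot_cvg.
Qed.

HB.instance Definition _ := bilinear_isBilinear.Build K l2sum l2sum K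
  *%R (conj R k \; *%R) l2dot (l2dot_linearl, l2dot_linearr).
HB.instance Definition _ := isHermitianSesquilinear.Build K l2sum false
  (conj R k) l2dot l2dotC.
HB.instance Definition _ := isDotProduct.Build K l2sum l2dot l2dot_gt0.
HB.instance Definition _ := Lmodule_isPreHilbert.Build R k l2sum l2dot.

End L2Sum.

Definition bounded_linear (R : realType) (k : base_field)
    (U V : preHilbertType R k) (T : U -> V) :=
  linear T /\ exists M : R, forall x, hnorm (T x) <= M * hnorm x.

Section Operators.
Context (R : realType) (k : base_field) (U V : preHilbertType R k).

(* Extended-real valued, so that an unbounded map has norm +oo. *)
Definition opnorm (T : U -> V) : \bar R :=
  ereal_sup [set (hnorm (T x))%:E | x in [set x | hnorm x <= 1]].

(* [adjoint T v] is the vector u such that <T x, v> = <x, u> for all x. *)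
Definition adjoint (T : U -> V) (v : V) : U :=
  xget 0 [set u | forall x, dot (T x) v = dot x u].

Record moore_penrose (T : U -> V) (S : V -> U) : Prop := MoorePenrose {
  mp_bounded : bounded_linear S;
  mp_inner : forall x, T (S (T x)) = T x;
  mp_outer : forall y, S (T (S y)) = S y;
  mp_selfadjointl : forall y y', dot (T (S y)) y' = dot y (T (S y'));
  mp_selfadjointr : forall x x', dot (S (T x)) x' = dot x (S (T x'))
}.

(* At most one S satisfies [moore_penrose T S]; one does when T is a bounded
   operator with closed range between Hilbert spaces. *)
Definition mp_inverse (T : U -> V) : V -> U :=
  xget (fun=> 0) [set S | moore_penrose T S].

End Operators.

Section FusionFrames.
Context (R : realType) (k : base_field) (H : hilbertType R k) (I : countType).
Implicit Types (M : closedSubspace H) (Ms : I -> closedSubspace H) (m : I -> R).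

Record fusion_frame M Ms m : Prop := FusionFrame {
  ff_sub : forall i, (Ms i : set H) `<=` M;
  ff_weight_gt0 : forall i, 0 < m i;
  ff_weight_bounded : exists C : R, forall i, m i <= C;
  ff_bounds : exists alpha beta : R, [/\ 0 < alpha, alpha <= beta &
    forall f, (M : set H) f ->
      ((alpha * hnorm f ^+ 2)%:E <=
        \esum_(i in [set: I]) (m i ^+ 2 * hnorm (oproj (Ms i) f) ^+ 2)%:E <=
        (beta * hnorm f ^+ 2)%:E)%E]
}.

Definition synthesis Ms m (f : l2sum Ms) : H :=
  summability.sum (fun i => ofR (m i) *: f i).

Arguments synthesis : clear implicits.

Definition analysis Ms m : H -> l2sum Ms := adjoint (synthesis Ms m).

(* T_{V,v} Q T_{W,w}^* *)
Definition mixed_operator (Ws : I -> closedSubspace H) (w : I -> R)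
    (Vs : I -> closedSubspace H) (v : I -> R) (Q : l2sum Ws -> l2sum Vs)
    (f : H) : H :=
  synthesis Vs v (Q (analysis Ws w f)).

Definition approx_oblique_dual (W V : closedSubspace H)
    (Ws : I -> closedSubspace H) (w : I -> R)
    (Vs : I -> closedSubspace H) (v : I -> R)
    (Q : l2sum Ws -> l2sum Vs) (eps : R) :=
  (opnorm (fun f => (mixed_operator w v Q f
             - projection V (orthocomp W) f)%R : H) <= eps%:E)%E.

Definition consistent_reconstruction (V : closedSubspace H)
    (Ws : I -> closedSubspace H) (w : I -> R) (eta : R) (f fr : H) :=
  (V : set H) fr /\
  hnorm (analysis Ws w fr - analysis Ws w f) <= eta * hnorm f.

End FusionFrames.

Arguments synthesis {R k H I} Ms m f.
Arguments analysis {R k H I} Ms m f.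

(* Main.v *)
From HB Require Import structures.
From mathcomp Require Import all_boot all_order all_algebra finmap.
From mathcomp Require Import all_classical all_reals ereal topology normedtype.
From mathcomp Require Import sesquilinear complex esum ring lra.
From mathcomp Require summability.
Require Import Defs.

(** Write T for the synthesis operator of (W, w), T* for its adjoint, pi for
    the oblique projection onto V along the orthogonal complement of W, and
    g = f_r - pi f, which belongs to V.

    Since f - pi f is orthogonal to W and T* vanishes on the orthogonal
    complement of W, T* f_r - T* f = T* g ([analysis_oblique_projection]). Thus
    both parts compare |g|, the error of approximate duality, with |T* g|, the
    error of consistency.

    In (ii), |T* g| <= |T| |g| because an operator and its adjoint satisfy the
    same bounds ([adjoint_bound]), and |g| <= eps |f| by approximate duality.

    In (i), let p be the orthogonal projection of g onto W. Then g = pi p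
    ([oblique_projection_oproj]) and T* g = T* p ([analysis_oproj]). The
    pseudo-inverse gives |p| <= |T^+| |T* p| ([hnorm_le_pinv]), so that
    |g| <= |pi| |T^+| |T* g| ([consistent_error_le]), which is exactly the
    inequality for which the constant in (i) is chosen.

    The operators have to be made explicit before this argument applies.
    Orthogonal projections exist by the usual minimization argument
    ([orthogonal_decomposition]). The upper frame bound gives the unconditional
    convergence of the synthesis series ([synthesis_cvg]), and identifies the
    analysis operator as f |-> (w_i pi_i f) ([analysisP]); the lower frame
    bound makes it injective on W ([analysis_inj]). *)

Set Implicit Arguments.
Unset Strict Implicit.
Unset Printing Implicit Defensive.

Import Order.TTheory GRing.Theory Num.Theory.
Import numFieldNormedType.Exports.
Local Open Scope classical_set_scope.
Local Open Scope ring_scope.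

(** * Scalars *)

Section Scalars.
Context {R : realType} {k : base_field}.
Local Notation K := (scalar R k).

Lemma re_ofR (r : R) : re (ofR r : K) = r.
Proof. by case: k. Qed.

Lemma re1 : re (1 : K) = 1.
Proof. by case: k. Qed.

Lemma ler_ofR (r s : R) : (ofR r <= ofR s :> K) = (r <= s).
Proof. by case: k => //; rewrite /ofR lecE/= eqxx. Qed.

Lemma re_gt0 (a : K) : 0 < a -> 0 < re a.
Proof. by case: k a => [a|a] //=; rewrite ltcE/= => /andP[]. Qed.

Lemma ofR_gt0 (r : R) : 0 < r -> 0 < ofR r :> K.
Proof.
move=> r0; rewrite lt_def ofR_ge0 ?(ltW r0)// andbT.
by apply: contraTneq r0 => /(congr1 re); rewrite re_ofR re0 => ->; rewrite ltxx.
Qed.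

Lemma re_ofRM (r : R) (a : K) : re (ofR r * a) = r * re a.
Proof. by case: k a => [a|[x y]] //=; rewrite mul0r subr0. Qed.

Lemma re_conj (a : K) : re (conj R k a) = re a.
Proof. by case: k a => [a|[x y]]. Qed.

Lemma conj_ofR (r : R) : conj R k (ofR r) = ofR r.
Proof. by case: k => //=; exact: conjc_real. Qed.

Lemma norm_ofR (r : R) : `|ofR r : K| = ofR `|r|.
Proof. by case: k => //=; rewrite normc_def/= expr0n addr0 sqrtr_sqr. Qed.

Lemma reN (a : K) : re (- a) = - re a.
Proof. by case: k a => [a|[x y]]. Qed.

Lemma re_sum (J : Type) (s : seq J) (a : J -> K) :
  re (\sum_(i <- s) a i) = \sum_(i <- s) re (a i).
Proof. exact: (big_morph re reD re0). Qed.

End Scalars.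

(** * Inner product spaces *)

Section InnerProduct.
Context {R : realType} {k : base_field} {V : preHilbertType R k}.
Local Notation K := (scalar R k).
Implicit Types (x y u v : V) (a : K).

Lemma dot0l x : dot 0 x = 0. Proof. exact: linear0l. Qed.
Lemma dotNl x y : dot (- x) y = - dot x y. Proof. exact: linearNl. Qed.
Lemma dotNr x y : dot x (- y) = - dot x y.
Proof. by rewrite dotC dotNl rmorphN/= -dotC. Qed.
Lemma dotBl x y z : dot (x - y) z = dot x z - dot y z.
Proof. by rewrite dotDl dotNl. Qed.
Lemma dotBr x y z : dot x (y - z) = dot x y - dot x z.
Proof. by rewrite dotDr dotNr. Qed.

Lemma dot_suml (J : Type) (s : seq J) (f : J -> V) y :
  dot (\sum_(i <- s) f i) y = \sum_(i <- s) dot (f i) y.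
Proof.
by apply: (big_morph (fun x => dot x y)) => [u v|]; [exact: dotDl|exact: dot0l].
Qed.

Lemma re_dotC x y : re (dot x y) = re (dot y x).
Proof. by rewrite dotC re_conj. Qed.

Lemma hnorm_ge0 x : 0 <= hnorm x. Proof. exact: sqrtr_ge0. Qed.

Lemma hnorm0 : hnorm (0 : V) = 0.
Proof. by rewrite /hnorm dot0l re0 sqrtr0. Qed.

Lemma hnorm_eq0 x : hnorm x = 0 -> x = 0.
Proof.
move=> x0; apply/dot_eq0/re_nneg_eq0; first exact: dot_ge0.
by rewrite -sqr_hnorm x0 expr0n.
Qed.

Lemma hnormN x : hnorm (- x) = hnorm x.
Proof. by rewrite /hnorm dotNl dotNr opprK. Qed.

Lemma hnormZ a x : hnorm (a *: x) = re `|a| * hnorm x.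
Proof.
apply/eqP; rewrite -(eqrXn2 (n := 2)) ?hnorm_ge0 ?mulr_ge0 ?re_ge0 ?hnorm_ge0//.
by rewrite exprMn !sqr_hnorm dotZZ !expr2 -mulrA !reM// mulrA.
Qed.

Lemma sqr_hnormD x y :
  hnorm (x + y) ^+ 2 = hnorm x ^+ 2 + 2 * re (dot x y) + hnorm y ^+ 2.
Proof.
rewrite !sqr_hnorm dotDl !dotDr !reD (re_dotC y x).
by rewrite mulr2n mulrDl mul1r !addrA.
Qed.

Lemma sqr_hnormB x y :
  hnorm (x - y) ^+ 2 = hnorm x ^+ 2 - 2 * re (dot x y) + hnorm y ^+ 2.
Proof. by rewrite sqr_hnormD hnormN dotNr reN mulrN. Qed.

(** Cauchy-Schwarz for the real part, in both base fields at once: expand the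
    squared norm of |y| x - |x| y, whose coefficients are real. *)
Lemma re_dot_le x y : re (dot x y) <= hnorm x * hnorm y.
Proof.
have [x0|x0] := eqVneq (hnorm x) 0.
  by rewrite (hnorm_eq0 x0) dot0l re0 hnorm0 mul0r.
have [y0|y0] := eqVneq (hnorm y) 0.
  by rewrite (hnorm_eq0 y0) dotC dot0l rmorph0 re0 hnorm0 mulr0.
have xp : 0 < hnorm x by rewrite lt_def x0 hnorm_ge0.
have yp : 0 < hnorm y by rewrite lt_def y0 hnorm_ge0.
have := sqr_ge0 (hnorm ((ofR (hnorm y) : K) *: x - (ofR (hnorm x) : K) *: y)).
rewrite sqr_hnormB !hnormZ dotZl dotZr conj_ofR !re_ofRM !norm_ofR !re_ofR.
rewrite !ger0_norm ?hnorm_ge0//.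
move: (hnorm x) (hnorm y) (re _) xp yp => s t r s0 t0 h.
have st : 0 < s * t by exact: mulr_gt0.
rewrite -(ler_pM2l st); nra.
Qed.

(** Multiplying x by the phase of the conjugate of <x, y> makes the product
    real and nonnegative, so the bound on real parts applies. *)
Lemma norm_dot_le x y : re `|dot x y| <= hnorm x * hnorm y.
Proof.
set z := dot x y; have [->|z0] := eqVneq z 0.
  by rewrite normr0 re0 mulr_ge0 ?hnorm_ge0.
have nz : `|z| != 0 by rewrite normr_eq0.
have <- : dot ((conj R k z / `|z|) *: x) y = `|z|.
  by rewrite dotZl -/z mulrAC (mulrC _ z) mul_conj expr2 mulfK.
apply: le_trans (re_dot_le _ _) _; rewrite hnormZ.
rewrite normrM normfV normr_id norm_conj divff//.
by rewrite re1 mul1r.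
Qed.

Lemma hnormD_le x y : hnorm (x + y) <= hnorm x + hnorm y.
Proof.
rewrite -(@ler_pXn2r _ 2) ?nnegrE ?addr_ge0 ?hnorm_ge0// sqr_hnormD sqrrD.
by rewrite lerD2r lerD2l -[leRHS]mulr_natl ler_pM2l// re_dot_le.
Qed.

End InnerProduct.

(** * Convergence in the real-valued norm *)

Section Convergence.
Context {R : realType} {k : base_field} {H : hilbertType R k}.
Local Notation K := (scalar R k).
Implicit Types (x y l : H).

(** The topology of H is given by a norm with values in the possibly complex
    field of scalars; this reduces convergence to inequalities in R. *)
Lemma hnorm_cvgP (T : Type) (F : set_system T) (FF : Filter F) (u : T -> H) l :
  (forall e : R, 0 < e -> \forall t \near F, hnorm (l - u t) <= e) <->
  u @ F --> l.
Proof.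
split=> [h|/cvgrPdist_le h].
  apply/cvgrPdist_le => e e0; near=> t.
  rewrite norm_hnorm -(ofR_re (ltW e0)) ler_ofR; near: t.
  exact/h/re_gt0.
move=> e e0; near=> t; rewrite -(@ler_ofR _ k) -norm_hnorm; near: t.
exact/h/ofR_gt0.
Unshelve. all: by end_near. Qed.

Lemma hnorm_cauchy_cvg (T : Type) (F : set_system T) (FF : ProperFilter F)
    (u : T -> H) :
  (forall e : R, 0 < e -> exists x, \forall t \near F, hnorm (x - u t) < e) ->
  exists l, u @ F --> l.
Proof.
move=> h; apply/cvg_ex; apply: cauchy_cvg; apply: cauchy_exP => e e0.
have [x hx] := h _ (re_gt0 e0); exists x.
change (F (fun t => ball x e (u t))); apply: filterS hx => t.
rewrite -ball_normE/= norm_hnorm -(ofR_re (ltW e0)) [in X in _ -> X]lt_def.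
rewrite ler_ofR lt_def re_ofR => /andP[ne ->]; rewrite andbT.
by apply: contra ne => /eqP/(congr1 re); rewrite !re_ofR => ->.
Qed.

Lemma hnorm_cvg_le (T : Type) (F : set_system T) (FF : ProperFilter F)
    (u : T -> H) l (c : R) :
  u @ F --> l -> (\forall t \near F, hnorm (u t) <= c) -> hnorm l <= c.
Proof.
move=> /hnorm_cvgP ul uc; apply/ler_addgt0Pr => e e0.
have [t [h1 h2]] := filter_ex (filterI uc (ul e e0)).
rewrite -[l](subrK (u t)) addrC; apply: le_trans (hnormD_le _ _) _.
by rewrite lerD.
Qed.

Lemma cvg_dotl (T : Type) (F : set_system T) (FF : Filter F)
    (u : T -> H) l y :
  u @ F --> l -> (fun t => dot (u t) y) @ F --> dot l y.
Proof.
move=> /hnorm_cvgP ul; apply/cvgrPdist_le => e e0.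
have e1 : 0 < re e / (hnorm y + 1).
  by rewrite divr_gt0 ?re_gt0// ltr_wpDl ?hnorm_ge0.
near=> t; rewrite -dotBl -(ofR_re (normr_ge0 _)) -(ofR_re (ltW e0)) ler_ofR.
apply: le_trans (norm_dot_le _ _) _.
apply: (@le_trans _ _ (re e / (hnorm y + 1) * (hnorm y + 1))).
  by apply: ler_pM; rewrite ?hnorm_ge0 ?lerDl//; near: t; exact: ul.
by rewrite divfK// gt_eqF// ltr_wpDl ?hnorm_ge0.
Unshelve. all: by end_near. Qed.

End Convergence.

(** * Orthogonal and oblique projections *)

Section Subspace.
Context {R : realType} {k : base_field} {H : hilbertType R k}.
Local Notation K := (scalar R k).
Implicit Types (M N : closedSubspace H) (x y p : H).

Lemma subspaceD M x y : (M : set H) x -> (M : set H) y -> (M : set H) (x + y).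
Proof. by move=> Mx; rewrite -[x]scale1r; exact: subspaceP. Qed.

Lemma subspaceZ M (a : K) x : (M : set H) x -> (M : set H) (a *: x).
Proof. by move=> Mx; rewrite -[_ *: _]addr0; apply: subspaceP (subspace0 M). Qed.

Lemma subspaceB M x y : (M : set H) x -> (M : set H) y -> (M : set H) (x - y).
Proof.
by move=> Mx My; rewrite -scaleN1r; apply: subspaceD => //; exact: subspaceZ.
Qed.

Lemma orthocompC M x y : (M : set H) x -> orthocomp M y -> dot x y = 0.
Proof. by move=> Mx My; rewrite dotC My// rmorph0. Qed.

Lemma orthocompB M x y :
  orthocomp M x -> orthocomp M y -> orthocomp M (x - y).
Proof. by move=> Mx My z Mz; rewrite dotBl Mx// My// subrr. Qed.

Lemma orthocompZ M (a : K) x : orthocomp M x -> orthocomp M (a *: x).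
Proof. by move=> Mx z Mz; rewrite dotZl Mx// mulr0. Qed.

Lemma orthocompN M x : orthocomp M x -> orthocomp M (- x).
Proof. by move=> Mx z Mz; rewrite dotNl Mx// oppr0. Qed.

Lemma orthocomp_meet M x : (M : set H) x -> orthocomp M x -> x = 0.
Proof. by move=> Mx /(_ _ Mx)/dot_eq0. Qed.

(** The elements of M at squared distance at most d + e from x, where d is the
    infimum of the squared distances, generate a Cauchy filter by the
    parallelogram law; its limit stays in M because M is closed. *)
Lemma exists_closest M x : exists2 p, (M : set H) p &
  forall m, (M : set H) m -> hnorm (x - p) ^+ 2 <= hnorm (x - m) ^+ 2.
Proof.
pose D := [set hnorm (x - m) ^+ 2 | m in (M : set H)].
have Dge0 : lbound D 0 by move=> _ [m _ <-]; exact: sqr_ge0.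
have D0 : D !=set0 by exists (hnorm (x - 0) ^+ 2), 0 => //; exact: subspace0.
have infD : has_inf D by split => //; exists 0.
pose d := inf D.
have dle m : (M : set H) m -> d <= hnorm (x - m) ^+ 2.
  by move=> Mm; apply: ge_inf; [exists 0|exists m].
pose A (e : R) := [set m | (M : set H) m /\ hnorm (x - m) ^+ 2 <= d + e].
have A0 e : 0 < e -> A e !=set0.
  by move=> /(inf_adherent)/(_ infD)[_ [m Mm <-] /ltW me]; exists m.
pose F := filter_from [set e : R | 0 < e] A.
have FF : ProperFilter F.
  apply: filter_from_proper; last by move=> e; exact: A0.
  apply: filter_from_filter; first by exists 1 => /=.
  move=> e1 e2 /= e10 e20; exists (Num.min e1 e2).
    by rewrite /= lt_min e10.
  move=> m [Mm]; rewrite -lerBlDl le_min !lerBlDl => /andP[me1 me2].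
  by split; split.
have [p Fp] : exists p, id @ F --> p.
  apply: hnorm_cauchy_cvg => e e0.
  have e20 : 0 < e ^+ 2 / 8 by rewrite divr_gt0 ?exprn_gt0.
  have [m0 [Mm0 xm0]] := A0 _ e20; exists m0.
  exists (e ^+ 2 / 8) => // m [Mm xm] /=.
  (* The midpoint of m and m0 is in M, hence at squared distance at least d. *)
  have := dle _ (subspaceZ (ofR 2^-1) (subspaceD Mm Mm0)).
  have -> : x - (ofR 2^-1 : K) *: (m + m0) =
      (ofR 2^-1 : K) *: ((x - m) + (x - m0)).
    have {1}-> : x = (ofR 2^-1 : K) *: (x + x).
      rewrite scalerDr -scalerDl.
      suff -> : ofR 2^-1 + ofR 2^-1 = 1 :> K by rewrite scale1r.
      have half : 2^-1 + 2^-1 = 1 :> R by lra.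
      by case: k => //=; rewrite -rmorphD half rmorph1.
    by rewrite -scalerBr addrACA opprD.
  rewrite hnormZ norm_ofR re_ofR exprMn gtr0_norm ?invr_gt0// sqr_hnormD => hd.
  have -> : m0 - m = (x - m) - (x - m0) by rewrite opprB [RHS]addrC addrA subrK.
  rewrite -(@ltr_pXn2r _ 2) ?nnegrE ?hnorm_ge0 ?(ltW e0)//.
  rewrite sqr_hnormB; have e2 : 0 < e ^+ 2 by exact: exprn_gt0.
  move: hd; rewrite exprVn; move: xm0 xm; lra.
exists p.
  have FM : \forall m \near F, subspace_set M m by exists 1 => //= m [].
  exact: (@closed_cvg _ _ F _ id (subspace_set M) (@subspace_closed _ _ _ M)
    FM p Fp).
move=> m Mm; apply: (le_trans _ (dle _ Mm)); apply/ler_addgt0Pr => e e0.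
rewrite -[d + e]sqr_sqrtr; last first.
  by rewrite addr_ge0 ?(ltW e0)//; apply: lb_le_inf.
rewrite ler_pXn2r ?nnegrE ?hnorm_ge0 ?sqrtr_ge0//.
apply: (@hnorm_cvg_le _ _ _ _ F FF (fun m => x - m)).
  by apply: cvgB; [exact: cvg_cst|exact: Fp].
exists e => //= m' [_ xm']; rewrite -[leLHS]ger0_norm ?hnorm_ge0// -sqrtr_sqr.
exact: ler_wsqrtr.
Qed.

(** The closest point p works: otherwise moving p slightly along a y in M that
    is not orthogonal to x - p would bring it nearer to x. *)
Lemma orthogonal_decomposition M x :
  exists2 p, (M : set H) p & orthocomp M (x - p).
Proof.
have [p Mp pmin] := exists_closest M x; exists p => // y0 My0.
set q := x - p.
have req0 y : (M : set H) y -> re (dot q y) = 0.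
  move=> My; set r := re _; set n := hnorm y ^+ 2.
  have n0 : 0 <= n by exact: sqr_ge0.
  have n1 : 0 < n + 1 by rewrite ltr_wpDl.
  (* The gain 2 t r is linear in t and the loss t^2 n quadratic; this t is
     small enough for the gain to win, and avoids dividing by n = 0. *)
  pose t := r / (n + 1).
  have := pmin _ (subspaceD Mp (subspaceZ (ofR t) My)).
  rewrite opprD addrA -/q (sqr_hnormB q) dotZr conj_ofR re_ofRM hnormZ norm_ofR.
  rewrite re_ofR exprMn real_normK ?num_real// -/r -/n.
  have rt : r = t * (n + 1) by rewrite /t divfK// gt_eqF.
  clearbody t; rewrite rt; move: (hnorm q ^+ 2) => s h.
  have : t ^+ 2 * (n + 2) <= 0 by nra.
  rewrite pmulr_lle0 ?ltr_wpDl// => t2.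
  have /eqP : t ^+ 2 == 0 by rewrite eq_le t2 sqr_ge0.
  by move/eqP; rewrite sqrf_eq0 => /eqP->; rewrite mul0r.
(* The vanishing of the real parts on the whole of M gives that of the inner
   products: scale y0 by its own inner product with q. *)
have := req0 _ (subspaceZ (dot q y0) My0).
rewrite dotZr mulrC mul_conj => /re_nneg_eq0 -/(_ (exprn_ge0 _ (normr_ge0 _))).
by move=> /eqP; rewrite sqrf_eq0 normr_eq0 => /eqP.
Qed.

Lemma projectionP (M N : set H) x : (exists2 p, M p & N (x - p)) ->
  M (projection M N x) /\ N (x - projection M N x).
Proof.
by move=> [p Mp Np]; rewrite /projection; case: xgetP => [q _ //|/(_ p)]; case.
Qed.

Lemma oprojP M x :
  (M : set H) (oproj M x) /\ orthocomp M (x - oproj M x).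
Proof. by apply: projectionP; exact: orthogonal_decomposition. Qed.

(** Two decompositions of x differ by an element of V that lies in the
    orthogonal complement of W, hence by 0. *)
Lemma projection_orthocomp_eq (V W : closedSubspace H) x p :
  (V : set H) `&` orthocomp W = [set 0] ->
  (V : set H) p -> orthocomp W (x - p) -> projection V (orthocomp W) x = p.
Proof.
move=> VW Vp Wp.
have [Vq Wq] : (V : set H) (projection V (orthocomp W) x) /\
    orthocomp W (x - projection V (orthocomp W) x).
  by apply: projectionP; exists p.
apply/eqP; rewrite -subr_eq0; apply/eqP.
have : [set 0] (projection V (orthocomp W) x - p).
  rewrite -VW; split; first exact: subspaceB.
  by have := orthocompB Wp Wq; rewrite opprB addrC addrA subrK.
by [].
Qed.

Lemma oproj_eq M x p :
  (M : set H) p -> orthocomp M (x - p) -> oproj M x = p.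
Proof.
apply: projection_orthocomp_eq; apply/seteqP; split=> [y [My My']|y ->].
  exact: orthocomp_meet My My'.
by split=> [|z _]; [exact: subspace0|rewrite dot0l].
Qed.

Lemma dot_oproj M x y : (M : set H) x -> dot x (oproj M y) = dot x y.
Proof.
move=> Mx; have [_ My] := oprojP M y.
by rewrite -[in RHS](subrK (oproj M y) y) dotDr (orthocompC Mx My) add0r.
Qed.

Lemma hnorm_oproj_le M x : hnorm (oproj M x) <= hnorm x.
Proof.
have [Mp Mx] := oprojP M x.
rewrite -(@ler_pXn2r _ 2) ?nnegrE ?hnorm_ge0// -[in leRHS](subrK (oproj M x) x).
by rewrite sqr_hnormD Mx// re0 mulr0 addr0 lerDr sqr_ge0.
Qed.

End Subspace.

(** * Operator norms and adjoints *)

Section Operators.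
Context {R : realType} {k : base_field} {U V : preHilbertType R k}.
Local Notation K := (scalar R k).

Lemma opnorm_le (T : U -> V) (c : R) : 0 <= c ->
  (forall x, hnorm (T x) <= c * hnorm x) -> (opnorm T <= c%:E)%E.
Proof.
move=> c0 Tc; apply: ge_ereal_sup => _ [x x1 <-]; rewrite lee_fin.
by apply: le_trans (Tc x) _; rewrite -[leRHS]mulr1 ler_wpM2l.
Qed.

Lemma le_opnorm (T : U -> V) (c : R) : scalable T ->
  (opnorm T <= c%:E)%E -> forall x, hnorm (T x) <= c * hnorm x.
Proof.
move=> TZ Tc x; have [x0|x0] := eqVneq (hnorm x) 0.
  have -> : T x = 0 by rewrite (hnorm_eq0 x0) -(scale0r (0 : U)) TZ scale0r.
  by rewrite hnorm0 x0 mulr0.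
have xp : 0 < hnorm x by rewrite lt_def x0 hnorm_ge0.
pose y := (ofR (hnorm x)^-1 : K) *: x.
have cE a : re `|ofR (hnorm x)^-1 : K| * a = (hnorm x)^-1 * a.
  by rewrite norm_ofR re_ofR gtr0_norm ?invr_gt0.
have : ((hnorm (T y))%:E <= opnorm T)%E.
  by apply: ereal_sup_ubound; exists y => //=; rewrite /y hnormZ cE mulVf.
move=> /le_trans/(_ Tc); rewrite lee_fin /y TZ hnormZ cE.
by rewrite ler_pdivrMl// mulrC.
Qed.

Lemma le_fine_opnorm (T : U -> V) : scalable T ->
  opnorm T \is a fin_num -> forall x, hnorm (T x) <= fine (opnorm T) * hnorm x.
Proof. by move=> TZ Tfin; apply: le_opnorm => //; rewrite fineK. Qed.

Lemma opnorm_ge0 (T : U -> V) : (0 <= opnorm T)%E.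
Proof.
apply: (@le_trans _ _ (hnorm (T 0))%:E); first by rewrite lee_fin hnorm_ge0.
by apply: ereal_sup_ubound; exists 0 => //=; rewrite hnorm0.
Qed.

Lemma bounded_opnorm_fin_num (T : U -> V) (c : R) : 0 <= c ->
  (forall x, hnorm (T x) <= c * hnorm x) -> opnorm T \is a fin_num.
Proof.
move=> c0 Tc; rewrite ge0_fin_numE ?opnorm_ge0//.
exact: le_lt_trans (opnorm_le c0 Tc) (ltry _).
Qed.

Lemma fine_neq0_fin_num (a : \bar R) : fine a != 0 -> a \is a fin_num.
Proof. by case: a => //=; rewrite eqxx. Qed.

Variables (T : U -> V) (S : V -> U).
Hypothesis TS : forall x y, dot (T x) y = dot x (S y).

Lemma adjointE : adjoint T = S.
Proof.
apply/funext => y; rewrite /adjoint; case: xgetP => [u _ uP|/(_ (S y))]; last first.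
  by case=> x; rewrite TS.
apply/eqP; rewrite -subr_eq0; apply/eqP/dot_eq0.
by rewrite dotBr -uP TS subrr.
Qed.

Lemma adjoint_linear : linear T.
Proof.
move=> a x y; apply/eqP; rewrite -subr_eq0; apply/eqP/dot_eq0.
set z := (X in dot _ X).
by rewrite dotBl dotDl dotZl !TS dotDl dotZl subrr.
Qed.

(** The square of |S y| is <T (S y), y>, at most c |S y| |y|. *)
Lemma adjoint_bound (c : R) : 0 <= c ->
  (forall x, hnorm (T x) <= c * hnorm x) ->
  forall y, hnorm (S y) <= c * hnorm y.
Proof.
move=> c0 Tc y; have [->|Sy0] := eqVneq (hnorm (S y)) 0.
  by rewrite mulr_ge0 ?hnorm_ge0.
have Sy : 0 < hnorm (S y) by rewrite lt_def Sy0 hnorm_ge0.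
rewrite -(ler_pM2l Sy) -expr2 sqr_hnorm -TS.
apply: le_trans (re_dot_le _ _) _; rewrite mulrCA mulrA.
by rewrite ler_wpM2r ?hnorm_ge0// Tc.
Qed.

End Operators.

(** * The norm of an l2 direct sum *)

Section L2Norm.
Import summability.
#[local] Existing Instance totally_filter.
Context {R : realType} {k : base_field} {H : hilbertType R k} {I : countType}.
Local Notation K := (scalar R k).

Lemma norm_re_le (a : K) : `|re a| <= re `|a|.
Proof.
case: k a => [a|[x y]] //=.
by rewrite -sqrtr_sqr ler_wsqrtr// lerDl sqr_ge0.
Qed.

Lemma cvg_re (T : Type) (F : set_system T) (FF : Filter F)
    (u : T -> K) (l : K) :
  u @ F --> l -> (fun t => re (u t)) @ F --> re l.
Proof.
move=> /cvgrPdist_le ul; apply/cvgrPdist_le => e e0.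
apply: filterS (ul _ (ofR_gt0 e0)) => t lt.
rewrite -reN -reD; apply: le_trans (norm_re_le _) _.
by rewrite -[leRHS](@re_ofR _ k); exact: re_le.
Qed.

Lemma sum_fsetD (E : zmodType) (a : I -> E) (J J' : {fset I}) :
  (J `<=` J')%fset ->
  \sum_(i <- J') a i = \sum_(i <- J) a i + \sum_(i <- (J' `\` J)%fset) a i.
Proof.
move=> JJ'; rewrite [LHS](big_fsetID _ [in J])/=; congr (_ + _).
  apply: eq_fbigl => x; rewrite !inE; apply: andb_idl => xJ.
  exact: (fsubsetP JJ').
by apply: eq_fbigl => x; rewrite !inE andbC.
Qed.

Lemma l2_partial_sum_le (Ws : I -> closedSubspace H) (f : l2sum Ws)
    (J : {fset I}) :
  \sum_(i <- J) hnorm (f i) ^+ 2 <= hnorm f ^+ 2.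
Proof.
rewrite sqr_hnorm; apply: (cvgr_to_ge (cvg_re _ (@l2dot_cvg _ _ _ _ _ f f))).
exists J => // J' /= JJ'; rewrite partial_sumE re_sum (sum_fsetD _ JJ').
rewrite -[leLHS]addr0; apply: lerD.
  by apply: ler_sum => i _; rewrite sqr_hnorm.
by apply: sumr_ge0 => i _; rewrite re_ge0 ?dot_ge0.
Qed.

End L2Norm.

(** * Synthesis and analysis operators of a fusion frame *)

Section FusionFrame.
Import summability.
#[local] Existing Instance totally_filter.
Context {R : realType} {k : base_field} {H : hilbertType R k} {I : countType}.
Local Notation K := (scalar R k).
Variables (W : closedSubspace H) (Ws : I -> closedSubspace H) (w : I -> R).
Hypothesis ffW : fusion_frame W Ws w.

(** This transports the upper frame bound, which is only assumed on W, to the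
    whole of H. *)
Lemma oproj_sub (i : I) (f : H) : oproj (Ws i) (oproj W f) = oproj (Ws i) f.
Proof.
have [Wp Wf] := oprojP W f; have [Wip Wif] := oprojP (Ws i) f.
apply: oproj_eq => // y Wiy.
have Wy := ff_sub ffW Wiy.
have -> : oproj W f - oproj (Ws i) f =
    (f - oproj (Ws i) f) - (f - oproj W f).
  by rewrite opprB [RHS]addrC addrA subrK.
by rewrite dotBl Wif// Wf// subrr.
Qed.

Lemma bessel_bound : exists2 beta : R, 0 < beta & forall (f : H) (J : {fset I}),
  \sum_(i <- J) hnorm (ofR (w i) *: oproj (Ws i) f) ^+ 2 <= beta * hnorm f ^+ 2.
Proof.
have [alpha [beta [alpha0 ab bnd]]] := ff_bounds ffW.
have beta0 : 0 < beta by exact: lt_le_trans ab.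
exists beta => // f J; have [Wp _] := oprojP W f.
have /andP[_ h] := bnd _ Wp.
apply: (@le_trans _ _ (beta * hnorm (oproj W f) ^+ 2)); last first.
  by rewrite ler_pM2l// ler_pXn2r ?nnegrE ?hnorm_ge0// hnorm_oproj_le.
rewrite -lee_fin; apply: le_trans h; apply: ereal_sup_ubound.
exists [set` J] => //; rewrite fsbig_finite//= set_fsetK sumEFin; congr EFin.
apply: eq_bigr => i _; rewrite oproj_sub hnormZ norm_ofR re_ofR exprMn.
by rewrite real_normK ?num_real.
Qed.

Lemma frame_coefficients (f : H) :
  exists u : l2sum Ws, forall i, u i = (ofR (w i) : K) *: oproj (Ws i) f.
Proof.
have [beta beta0 bb] := bessel_bound.
have uP : (fun i => (ofR (w i) : K) *: oproj (Ws i) f) \in l2pred Ws.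
  apply/l2predP; split=> [i|]; first by apply: subspaceZ; case: (oprojP (Ws i) f).
  exists (beta * hnorm f ^+ 2) => J; apply: le_trans (bb f J).
  by apply: ler_sum => i _; rewrite sqr_hnorm.
by exists (L2Sum uP).
Qed.

(** With s the partial sum, |s|^2 is the sum of the <f_i, w_i pi_i s>. The
    weighted arithmetic-geometric inequality bounds twice this by
    beta * sum |f_i|^2 + (1 / beta) * sum |w_i pi_i s|^2, whose last term is at
    most |s|^2 by the Bessel bound. *)
Lemma synthesis_partial_bound : exists2 beta : R, 0 < beta &
  forall (f : l2sum Ws) (J : {fset I}),
  hnorm (\sum_(i <- J) (ofR (w i) : K) *: f i) ^+ 2 <=
    beta * \sum_(i <- J) hnorm (f i) ^+ 2.
Proof.
have [beta beta0 bb] := bessel_bound; exists beta => // f J.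
set s := \sum_(i <- J) _.
have := bb s J.
have -> : hnorm s ^+ 2 =
    \sum_(i <- J) re (dot (f i) ((ofR (w i) : K) *: oproj (Ws i) s)).
  rewrite sqr_hnorm {1}/s dot_suml re_sum; apply: eq_bigr => i _.
  have [fW _] := (l2predP _ _).1 (valP f).
  by rewrite dotZl dotZr conj_ofR dot_oproj.
set g := fun i => (ofR (w i) : K) *: oproj (Ws i) s.
set X := (X in _ <= _ * X -> _); set F := (X in _ -> _ <= _ * X) => bX.
suff : 2 * beta * X <= beta ^+ 2 * F + \sum_(i <- J) hnorm (g i) ^+ 2.
  by rewrite -(ler_pM2l beta0 X) mulrA -expr2; move: bX; rewrite -mulrA; lra.
rewrite !mulr_sumr -big_split/=; apply: ler_sum => i _.
have := sqr_ge0 (hnorm ((ofR beta : K) *: f i - g i)).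
rewrite sqr_hnormB hnormZ dotZl re_ofRM norm_ofR re_ofR gtr0_norm// exprMn.
by rewrite mulrA; lra.
Qed.

(** By the partial sum bound, the tails of the series are controlled by those
    of the summable family |f_i|^2, so that the partial sums are Cauchy. *)
Lemma synthesis_cvg (f : l2sum Ws) :
  partial_sum (fun i => (ofR (w i) : K) *: f i) @ totally --> synthesis Ws w f.
Proof.
suff [l sl] : exists l : H,
    partial_sum (fun i => (ofR (w i) : K) *: f i) @ totally --> l.
  have -> : synthesis Ws w f = l by apply: cvg_lim sl; exact: norm_hausdorff.
  exact: sl.
have [beta beta0 sb] := synthesis_partial_bound.
have [_ [M fM]] := (l2predP _ _).1 (valP f).
have [l al] : exists l : R,
    partial_sum (fun i => hnorm (f i) ^+ 2) @ totally --> l.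
  apply: (@nonneg_sum_cvg _ _ _ M) => [i|J]; first exact: sqr_ge0.
  by apply: le_trans (fM J); apply: ler_sum => i _; rewrite sqr_hnorm.
apply: hnorm_cauchy_cvg => e e0.
(* The tail is a difference of two partial sums, each this close to the limit,
   and the partial sum bound multiplies it by beta. *)
have d0 : 0 < e ^+ 2 / (4 * beta) by rewrite divr_gt0 ?exprn_gt0// mulr_gt0.
move/cvgrPdist_lt : al => /(_ _ d0)[J0 _ aJ].
exists (\sum_(i <- J0) (ofR (w i) : K) *: f i); exists J0 => // J /= J0J.
rewrite partial_sumE (sum_fsetD _ J0J) opprD addrA subrr add0r hnormN.
rewrite -(@ltr_pXn2r _ 2) ?nnegrE ?hnorm_ge0 ?(ltW e0)//.
apply: le_lt_trans (sb _ _) _.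
have := aJ _ (fsubset_refl _); have := aJ _ J0J; rewrite /= !partial_sumE.
rewrite (sum_fsetD _ J0J).
set a := \sum_(i <- J0) _; set b := \sum_(i <- _) _.
rewrite !ltr_norml => /andP[h1 _] /andP[_ h2].
have : b < 2 * (e ^+ 2 / (4 * beta)) by lra.
rewrite -(ltr_pM2l beta0) => /lt_le_trans; apply.
have -> : beta * (2 * (e ^+ 2 / (4 * beta))) = e ^+ 2 / 2.
  by field; rewrite gt_eqF.
by rewrite ler_pdivrMr// ler_peMr ?sqr_ge0// ler1n.
Qed.

Lemma synthesis_sub (f : l2sum Ws) : (W : set H) (synthesis Ws w f).
Proof.
have FW : \forall J \near totally,
    (W : set H) (partial_sum (fun i => (ofR (w i) : K) *: f i) J).
  exists fset0 => // J _; rewrite /= partial_sumE.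
  have [fW _] := (l2predP _ _).1 (valP f).
  apply: (big_ind (W : set H)) => [|x y Wx Wy|i _]; first exact: subspace0.
    exact: subspaceD.
  by apply: subspaceZ; apply: (ff_sub ffW); exact: fW.
exact: (@closed_cvg _ _ totally _ _ (W : set H) (@subspace_closed _ _ _ W) FW _
  (@synthesis_cvg f)).
Qed.

Lemma synthesis_bounded : exists2 c : R, 0 <= c &
  forall f : l2sum Ws, hnorm (synthesis Ws w f) <= c * hnorm f.
Proof.
have [beta beta0 sb] := synthesis_partial_bound.
exists (Num.sqrt beta) => [|f]; first exact: sqrtr_ge0.
apply: (hnorm_cvg_le _ (@synthesis_cvg f)); exists fset0 => // J _ /=.
rewrite partial_sumE -(@ler_pXn2r _ 2) ?nnegrE ?mulr_ge0 ?hnorm_ge0 ?sqrtr_ge0//.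
rewrite exprMn (sqr_sqrtr (ltW beta0)); apply: le_trans (sb f J) _.
by rewrite ler_pM2l// l2_partial_sum_le.
Qed.

Lemma synthesis_adjoint (f : l2sum Ws) (g : H) (u : l2sum Ws) :
  (forall i, u i = (ofR (w i) : K) *: oproj (Ws i) g) ->
  dot (synthesis Ws w f) g = dot f u.
Proof.
move=> ug; symmetry; apply: sum_unique.
suff -> : partial_sum (fun i => dot (f i) (u i)) =
    (fun J => dot (partial_sum (fun i => (ofR (w i) : K) *: f i) J) g).
  exact: cvg_dotl (@synthesis_cvg f).
apply/funext => J; rewrite !partial_sumE dot_suml; apply: eq_bigr => i _.
have [fW _] := (l2predP _ _).1 (valP f).
by rewrite ug dotZl dotZr conj_ofR dot_oproj.
Qed.

(** The explicit family (w_i pi_i f) satisfies the equation that determines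
    the adjoint, hence is the analysis operator. *)
Lemma analysisP :
  (forall f g, dot (synthesis Ws w f) g = dot f (analysis Ws w g))
  /\ forall g i, analysis Ws w g i = (ofR (w i) : K) *: oproj (Ws i) g.
Proof.
have [A AE] := choice frame_coefficients.
have TA f g : dot (synthesis Ws w f) g = dot f (A g).
  exact: synthesis_adjoint (AE g).
by rewrite /analysis (adjointE TA).
Qed.

Lemma analysis_linear : linear (analysis Ws w).
Proof.
apply: (@adjoint_linear _ _ _ _ _ (synthesis Ws w)) => g f.
by rewrite dotC -analysisP.1 -dotC.
Qed.

Lemma analysis_orthocomp f : orthocomp W f -> analysis Ws w f = 0.
Proof.
move=> Wf; apply: dot_eq0; rewrite -analysisP.1.
exact/orthocompC/Wf/synthesis_sub.
Qed.

(** If all the w_i pi_i f vanish, so does the middle term of the frame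
    inequality; the lower bound forces f = 0. *)
Lemma analysis_inj f : (W : set H) f -> analysis Ws w f = 0 -> f = 0.
Proof.
move=> Wf Af; have [alpha [beta [alpha0 _ bnd]]] := ff_bounds ffW.
have /andP[+ _] := bnd _ Wf.
rewrite esum1 => [|i _]; last first.
  have := congr1 (fun u : l2sum Ws => hnorm (u i) ^+ 2) Af.
  rewrite analysisP.2 hnormZ norm_ofR re_ofR exprMn real_normK ?num_real// => ->.
  by rewrite hnorm0 expr0n.
rewrite lee_fin pmulr_rle0// => f0; apply: hnorm_eq0; apply/eqP.
by rewrite -sqrf_eq0 eq_le f0 sqr_ge0.
Qed.

(** The composition T S is the identity on W: by the first and third Penrose
    equations p - T S p is orthogonal to the range of T, so it is killed by the
    analysis operator, and it is 0 by injectivity on W. Then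
    |p|^2 = <T S p, p> = <S p, T* p>, and Cauchy-Schwarz applies. *)
Lemma hnorm_le_pinv (S : H -> l2sum Ws) (p : H) :
  moore_penrose (synthesis Ws w) S -> opnorm S \is a fin_num -> (W : set H) p ->
  hnorm p <= fine (opnorm S) * hnorm (analysis Ws w p).
Proof.
move=> mpS Sfin Wp; have [[linS _] TST _ TSsa _] := mpS.
set T := synthesis Ws w; set A := analysis Ws w.
have TA : forall f g, dot (T f) g = dot f (A g) := analysisP.1.
have TSp : T (S p) = p.
  apply/eqP; rewrite eq_sym -subr_eq0; apply/eqP/analysis_inj.
    by apply: subspaceB => //; exact: synthesis_sub.
  by apply: dot_eq0; rewrite -TA dotBr -TSsa TST subrr.
have [->|p0] := eqVneq (hnorm p) 0.
  by rewrite mulr_ge0 ?hnorm_ge0// fine_ge0// opnorm_ge0.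
have pp : 0 < hnorm p by rewrite lt_def p0 hnorm_ge0.
rewrite -(ler_pM2l pp) -expr2 sqr_hnorm -{1}TSp TA.
apply: le_trans (re_dot_le _ _) _; rewrite mulrA ler_wpM2r ?hnorm_ge0// mulrC.
exact/le_fine_opnorm/Sfin/scalable_linear.
Qed.

End FusionFrame.

(** * Approximate duality and consistency *)

Section ObliqueProjection.
Context {R : realType} {k : base_field} {H : hilbertType R k}.
Variables V W : closedSubspace H.
Hypothesis VW : direct_sum V (orthocomp W).
Local Notation pi := (projection V (orthocomp W)).

Lemma oblique_projectionP x :
  (V : set H) (pi x) /\ orthocomp W (x - pi x).
Proof. by apply: projectionP; exact: VW.1. Qed.

Lemma oblique_projection_linear : linear pi.
Proof.
move=> a x y; have [Vx Wx] := oblique_projectionP x.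
have [Vy Wy] := oblique_projectionP y.
apply: (projection_orthocomp_eq VW.2); first exact: subspaceP.
rewrite opprD addrACA -scalerBr -[y - _]opprK.
by apply: orthocompB; [exact: orthocompZ|exact: orthocompN].
Qed.

Lemma oblique_projection_oproj x : (V : set H) x -> pi (oproj W x) = x.
Proof.
move=> Vx; have [_ Wx] := oprojP W x.
by apply: (projection_orthocomp_eq VW.2) => //; rewrite -opprB; exact: orthocompN.
Qed.

End ObliqueProjection.

Section Consistency.
Context {R : realType} {k : base_field} {H : hilbertType R k} {I : countType}.
Variables (V W : closedSubspace H) (Ws : I -> closedSubspace H) (w : I -> R).
Hypothesis VW : direct_sum V (orthocomp W).
Hypothesis ffW : fusion_frame W Ws w.
Local Notation pi := (projection V (orthocomp W)).

(** The residual f - pi f is orthogonal to W, which the analysis operator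
    annihilates: its measurements only see pi f. *)
Lemma analysis_oblique_projection f g :
  analysis Ws w g - analysis Ws w f = analysis Ws w (g - pi f).
Proof.
have linA := zmod_morphism_linear (analysis_linear ffW).
have [_ Wf] := oblique_projectionP VW f.
rewrite linA; congr (_ - _); apply/eqP; rewrite -subr_eq0 -linA; apply/eqP.
exact: (analysis_orthocomp ffW).
Qed.

Lemma analysis_oproj f : analysis Ws w (oproj W f) = analysis Ws w f.
Proof.
have linA := zmod_morphism_linear (analysis_linear ffW).
have [_ Wf] := oprojP W f.
by apply/eqP; rewrite eq_sym -subr_eq0 -linA (analysis_orthocomp ffW).
Qed.

(** An element g of V is the oblique projection of its orthogonal projection p
    onto W, and p is recovered from its coefficients through the
    pseudo-inverse: |g| <= |pi| |p| <= |pi| |T^+| |T* g|. *)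
Lemma consistent_error_le (eps r : R) (g : H) : 0 <= eps -> 0 <= r ->
  (V : set H) g ->
  hnorm (analysis Ws w g) <=
    eps / (fine (opnorm pi) * fine (opnorm (mp_inverse (synthesis Ws w)))) * r ->
  hnorm g <= eps * r.
Proof.
move=> eps0 r0 Vg; have [Wp _] := oprojP W g.
rewrite -analysis_oproj -{2}(oblique_projection_oproj VW Vg).
move: (oproj W g) Wp => p Wp.
set c1 := fine (opnorm pi); set S := mp_inverse _; set c2 := fine (opnorm S).
(* When the denominator is 0 (because a norm is 0, or infinite and sent to 0 by
   fine), the quotient is 0 as well, so that the coefficients of p vanish and
   p = 0. Otherwise both norms are finite, and the pseudo-inverse exists since
   its default value, the zero map, would have norm 0. *)
have [c0|c0] := eqVneq (c1 * c2) 0.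
  rewrite c0 invr0 mulr0 mul0r => Ap0.
  have -> : p = 0.
    apply: (analysis_inj ffW Wp); apply: hnorm_eq0.
    by apply/eqP; rewrite eq_le Ap0 hnorm_ge0.
  have -> : pi 0 = 0.
    by have := scalable_linear (oblique_projection_linear VW) 0 0; rewrite /= !scale0r.
  by rewrite hnorm0 mulr_ge0.
have : c1 != 0 /\ c2 != 0 by move: c0; rewrite mulf_eq0 negb_or => /andP.
move=> [/fine_neq0_fin_num pifin c20].
have Sfin := fine_neq0_fin_num c20.
have mpS : moore_penrose (synthesis Ws w) S.
  move: c20; rewrite /c2 /S /mp_inverse; case: xgetP => // _ /eqP[].
  apply/le_anti/andP; split; last by rewrite fine_ge0// opnorm_ge0.
  rewrite -lee_fin fineK; first by apply: opnorm_le => // x; rewrite hnorm0 mul0r.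
  by apply: (@bounded_opnorm_fin_num _ _ _ _ _ 0) => // x; rewrite hnorm0 mul0r.
move=> Ap.
have c1_0 : 0 <= c1 by rewrite fine_ge0// opnorm_ge0.
apply: le_trans (le_fine_opnorm _ pifin p) _.
  exact/scalable_linear/(oblique_projection_linear VW).
have c2_0 : 0 <= c2 by rewrite fine_ge0// opnorm_ge0.
apply: (@le_trans _ _ (c1 * c2 * hnorm (analysis Ws w p))).
  rewrite -mulrA ler_wpM2l//.
  exact: (hnorm_le_pinv ffW mpS Sfin Wp).
apply: le_trans (ler_wpM2l (mulr_ge0 c1_0 c2_0) Ap) _.
by rewrite mulrA mulrCA divff// mulr1.
Qed.

End Consistency.

Lemma mixed_operator_linear (R : realType) (k : base_field) (H : hilbertType R k)
  (I : countType) (V W : closedSubspace H)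
  (Ws Vs : I -> closedSubspace H) (w v : I -> R)
  (Q : l2sum Ws -> l2sum Vs) :
  fusion_frame W Ws w -> fusion_frame V Vs v -> linear Q ->
  linear (mixed_operator w v Q).
Proof.
move=> ffW ffV linQ a x y; rewrite /mixed_operator (analysis_linear ffW) linQ.
exact/adjoint_linear/(analysisP ffV).1.
Qed.

Theorem corollary3p16 (R : realType) (k : base_field) (H : hilbertType R k)
  (I : countType) (V W : closedSubspace H)
  (Ws Vs : I -> closedSubspace H) (w v : I -> R)
  (Q : l2sum Ws -> l2sum Vs) (eps : R) :
  separable H ->
  direct_sum V (orthocomp W) ->
  fusion_frame W Ws w ->
  fusion_frame V Vs v ->
  bounded_linear Q ->
  0 <= eps ->
  ((forall f : H,
      consistent_reconstruction V Ws w
        (eps / (fine (opnorm (projection V (orthocomp W)))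
                * fine (opnorm (mp_inverse (synthesis Ws w)))))
        f (mixed_operator w v Q f)) ->
   approx_oblique_dual W V w v Q eps)
  /\
  (approx_oblique_dual W V w v Q eps ->
   forall f : H,
     consistent_reconstruction V Ws w
       (eps * fine (opnorm (synthesis Ws w)))
       f (mixed_operator w v Q f)).
Proof.
move=> _ VW ffW ffV [linQ _] eps0; split=> [rec|dual f].
  apply: opnorm_le => // f; have [Vfr err] := rec f.
  apply: (consistent_error_le VW ffW) => //; first exact: hnorm_ge0.
    by apply: subspaceB => //; have [] := oblique_projectionP VW f.
  by rewrite -(analysis_oblique_projection VW ffW).
split; first exact: (synthesis_sub ffV).
rewrite (analysis_oblique_projection VW ffW).
have [c c0 Tc] := synthesis_bounded ffW.
have Tfin := bounded_opnorm_fin_num c0 Tc.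
have T0 : 0 <= fine (opnorm (synthesis Ws w)) by rewrite fine_ge0// opnorm_ge0.
have TT x : hnorm (synthesis Ws w x) <=
    fine (opnorm (synthesis Ws w)) * hnorm x.
  apply: le_fine_opnorm Tfin x.
  exact/scalable_linear/adjoint_linear/(analysisP ffW).1.
apply: le_trans (adjoint_bound (analysisP ffW).1 T0 TT _) _.
rewrite mulrAC mulrC ler_wpM2r//; apply: le_opnorm dual f => a x.
rewrite (scalable_linear (mixed_operator_linear ffW ffV linQ)).
by rewrite (scalable_linear (oblique_projection_linear VW)) scalerBr.
Qed.
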